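(* The partial ordering $\mathcal{T}(\mathcal{B}(\cdot))$ is order-isomorphic to the partial ordering $\overline{\mathbb{T}}_2$.
   Context: **Binary trees.** For a partial order $X$, $\mathcal{B}(X)$ is the set of finite structured (left/right ordered) binary trees with leaves labelled by elements of $X$ and unlabelled internal nodes (each internal node has exactly a left and a right immediate subtree). The ordering is tree embeddability: $B\le B'$ iff either $B,B'$ are single nodes with labels $x,x'$ and $x\leq_X x'$; or $B'$ has left and right immediate subtrees $B'_1,B'_2$ and ($B\le B'_1$, or $B\le B'_2$, or $B$ has left and right immediate subtrees $B_1,B_2$ with $B_1\le B'_1$ and $B_2\le B'_2$). **The ordering $\mathcal{T}(\mathcal{B}(\cdot))$.** $\mathcal{T}(\mathcal{B}(\cdot))$ is the least set such that $\circ\in\mathcal{T}(\mathcal{B}(\cdot))$, and whenever $B=B(t_1,\dots,t_n)$ is a finite structured binary tree whose leaf labels $t_1,\dots,t_n$ are in $\mathcal{T}(\mathcal{B}(\cdot))$, then the formal term $\circ[B(t_1,\dots,t_n)]$ is in $\mathcal{T}(\mathcal{B}(\cdot))$. Its ordering $\leq$ is the least reflexive and transitive relation such that: (1) $\circ\leq t$ for all $t$; (2) if $s\leq t_j$ for some $j$, then $s\leq\circ[B(t_1,\dots,t_n)]$; (3) if $B(t_1,\dots,t_n)\leq B'(t'_1,\dots,t'_m)$ in $\mathcal{B}(\mathcal{T}(\mathcal{B}(\cdot)),\leq)$, then $\circ[B(t_1,\dots,t_n)]\leq\circ[B'(t'_1,\dots,t'_m)]$. **Friedman's trees with (weak) gap-embeddability.**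 $\mathbb{T}_n$ is the set of pairs $(T,l)$ where $T$ is a finite rooted tree, viewed as a partial ordering on its nodes (root least), and $l:T\to\{0,\dots,n-1\}$ is a labelling. $(T_1,l_1)\leq_{gap}(T_2,l_2)$ iff there is an injective order- and infimum-preserving map $f:T_1\to T_2$ such that (1) $l_1(\tau)=l_2(f(\tau))$ for all $\tau\in T_1$; (2) for all $\tau\in T_1$ and all immediate successors $\tau'$ of $\tau$ in $T_1$, if $\overline{\tau}\in T_2$ and $f(\tau)<\overline{\tau}<f(\tau')$, then $l_2(\overline{\tau})\geq l_2(f(\tau'))=l_1(\tau')$. **The ordering $\overline{\mathbb{T}}_2$.** $\overline{\mathbb{T}}_2$ consists of the trees in $\mathbb{T}_2$ (up to isomorphism) whose root has label $0$, in which every node with label $0$ has zero or one immediate successor, and every node with label $1$ has exactly two immediate successors. In addition the trees in $\overline{\mathbb{T}}_2$ are taken to be structured: the two immediate successors of a node with label $1$ are distinguished as left and right, and embeddings witnessing the ordering ($\leq_{gap}$) are required to preserve this left-right order (nodes on the left, respectively right, side above a label-$1$ node $\tau$ are mapped to the left, respectively right, side above $f(\tau)$). *)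

(* Defs.v *)
From HB Require Import structures.
From mathcomp Require Import all_boot all_order.

Set Implicit Arguments.
Unset Strict Implicit.
Unset Printing Implicit Defensive.

Local Open Scope order_scope.

Definition order_isomorphic (A B : Type) (leA : A -> A -> Prop)
    (leB : B -> B -> Prop) : Prop :=
  exists f : A -> B, bijective f /\ forall x y, leA x y <-> leB (f x) (f y).

Inductive btree (X : Type) : Type :=
| Leaf of X
| Node of btree X & btree X.

Fixpoint is_leaf_label (X : Type) (x : X) (B : btree X) : Prop :=
  match B with
  | Leaf y => x = y
  | Node B1 B2 => is_leaf_label x B1 \/ is_leaf_label x B2
  end.

Inductive btree_le (X : Type) (leX : X -> X -> Prop) :
    btree X -> btree X -> Prop :=
| btree_le_leaf x x' : leX x x' -> btree_le leX (Leaf x) (Leaf x')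
| btree_le_left B B1 B2 : btree_le leX B B1 -> btree_le leX B (Node B1 B2)
| btree_le_right B B1 B2 : btree_le leX B B2 -> btree_le leX B (Node B1 B2)
| btree_le_node B1 B2 B1' B2' :
    btree_le leX B1 B1' -> btree_le leX B2 B2' ->
    btree_le leX (Node B1 B2) (Node B1' B2').

(* The terms of T(B(.)): [Circ] is the constant, [CircB B] is the formal term
   circ[B(t_1, ..., t_n)], where B has leaf labels t_1, ..., t_n. *)
Inductive TB : Type :=
| Circ
| CircB of btree TB.

Inductive TB_le : TB -> TB -> Prop :=
| TB_le_refl t : TB_le t t
| TB_le_trans s t u : TB_le s t -> TB_le t u -> TB_le s u
| TB_le_circ t : TB_le Circ t
| TB_le_sub s t B : is_leaf_label t B -> TB_le s t -> TB_le s (CircB B)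
| TB_le_btree B B' : btree_le TB_le B B' -> TB_le (CircB B) (CircB B').

(* The root is [\bot]; the last axiom says that the predecessors of each node
   form a chain, i.e. that the partial order is a tree. *)
Record ltree (n : nat) : Type := LTree {
  ltree_disp : Order.disp_t;
  ltree_node :> finBPOrderType ltree_disp;
  label : ltree_node -> 'I_n;
  ltree_chain : forall x y z : ltree_node, y <= x -> z <= x -> y >=< z
}.

Section PosetNotions.
Variables (d : Order.disp_t) (T : porderType d).

Definition immediate_succ (x y : T) : Prop :=
  x < y /\ forall z : T, ~ (x < z /\ z < y).

Definition is_inf (x y z : T) : Prop :=
  [/\ z <= x, z <= y & forall w : T, w <= x -> w <= y -> w <= z].

End PosetNotions.

Definition gap_embedding (n : nat) (T1 T2 : ltree n) (f : T1 -> T2) : Prop :=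
  [/\ injective f,
      forall x y : T1, x <= y -> f x <= f y,
      forall x y z : T1, is_inf x y z -> is_inf (f x) (f y) (f z),
      forall x : T1, label x = label (f x)
    & forall (x y : T1) (z : T2), immediate_succ x y ->
        f x < z -> z < f y -> (label (f y) <= label z)%N].

(* [lsucc x] and [rsucc x] are the left and right immediate successors of a
   node x with label 1; their values at nodes with label 0 are irrelevant, and
   are ignored by the embeddings and isomorphisms below. *)
Record stree : Type := STree {
  stree_tree :> ltree 2;
  lsucc : stree_tree -> stree_tree;
  rsucc : stree_tree -> stree_tree;
  stree_root : label (\bot : stree_tree) = 0 :> nat;
  stree_succ0 : forall x y z : stree_tree, label x = 0 :> nat ->
    immediate_succ x y -> immediate_succ x z -> y = z;
  stree_succ1 : forall x : stree_tree, label x = 1 :> nat ->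
    lsucc x <> rsucc x /\
    forall y, immediate_succ x y <-> y = lsucc x \/ y = rsucc x
}.

Definition stree_le (T1 T2 : stree) : Prop :=
  exists f : T1 -> T2,
    [/\ gap_embedding f,
        forall x y : T1, label x = 1 :> nat ->
          lsucc x <= y -> lsucc (f x) <= f y
      & forall x y : T1, label x = 1 :> nat ->
          rsucc x <= y -> rsucc (f x) <= f y].

Definition stree_iso (T1 T2 : stree) : Prop :=
  exists f : T1 -> T2,
    [/\ bijective f,
        forall x y : T1, (f x <= f y) = (x <= y),
        forall x : T1, label (f x) = label x
      & forall x : T1, label x = 1 :> nat ->
          f (lsucc x) = lsucc (f x) /\ f (rsucc x) = rsucc (f x)].

(* Trees up to isomorphism: isomorphism classes, as predicates on [stree]. *)
Definition Tbar2 : Type :=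
  {C : stree -> Prop | exists T, forall T', C T' <-> stree_iso T T'}.

Definition Tbar2_le (C D : Tbar2) : Prop :=
  exists T1 T2 : stree, [/\ sval C T1, sval D T2 & stree_le T1 T2].

(* Main.v *)
(** A term of T(B(.)) and the corresponding tree in \bar{T}_2 carry
    the same information: the label-0 nodes are the subterms, and the label-1
    nodes are the internal nodes of the binary trees occurring in the term.  By
    the gap condition, a label-1 node skips only label-1 nodes, hence stays
    within a single binary tree (clause (3) of the ordering of terms), while a
    label-0 node may land in any deeper subterm (clause (2)).  Both orderings
    are equivalent to an inductive relation [emb] without a transitivity rule,
    and gap embeddings amount to maps between addresses of nodes. *)
Require Import Defs.
From HB Require Import structures.
From mathcomp Require Import all_boot all_order.
From mathcomp Require Import boolp.
Import Order.TTheory.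

Set Implicit Arguments.
Unset Strict Implicit.
Unset Printing Implicit Defensive.

(** * Terms as finite trees with unary and binary nodes *)

(* [Lf] and [Un] are the nodes with label 0, [Bin] those with label 1. *)
Inductive utree : Type := Lf | Un of utree | Bin of utree & utree.

Definition nonbin (t : utree) : bool := if t is Bin _ _ then false else true.

Fixpoint graft (X : Type) (f : X -> utree) (B : btree X) : utree :=
  match B with
  | Leaf x => f x
  | Node B1 B2 => Bin (graft f B1) (graft f B2)
  end.

Fixpoint utree_of (s : TB) : utree :=
  match s with
  | Circ => Lf
  | CircB B => Un (graft utree_of B)
  end.

(** Terms are exactly the [nonbin] trees, but the inverse is defined on all of [utree]: an arbitrary
    tree is a binary tree labelled by terms, and a term appears as a single leaf. *)
Fixpoint btree_of (t : utree) : btree TB :=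
  match t with
  | Lf => Leaf Circ
  | Un t => Leaf (CircB (btree_of t))
  | Bin t1 t2 => Node (btree_of t1) (btree_of t2)
  end.

Lemma nonbin_utree_of s : nonbin (utree_of s).
Proof. by case: s. Qed.

Lemma utree_ofK s : btree_of (utree_of s) = Leaf s.
Proof.
(* [TB] is nested in [btree]: the recursion on terms reaches the labels through an inner induction
   on [B]. *)
move: s; fix IH 1 => -[|B] //=; congr (Leaf (CircB _)).
by elim: B => [x|B1 IH1 B2 IH2] /=; [exact: IH | rewrite IH1 IH2].
Qed.

Lemma btree_ofK t : graft utree_of (btree_of t) = t.
Proof. by elim: t => //= [t ->|t1 -> t2 ->]. Qed.

Lemma utree_of_inj : injective utree_of.
Proof. by move=> s t e; have := utree_ofK s; rewrite e utree_ofK => -[]. Qed.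

Lemma utree_of_surj t : nonbin t -> exists s, utree_of s = t.
Proof.
case: t => // [|t] _; first by exists Circ.
by exists (CircB (btree_of t)); rewrite /= btree_ofK.
Qed.

(** * The ordering of terms as an inductive embedding without transitivity rule *)

(* The premise [nonbin s] of [emb_Un] is the gap condition: the embedding of
   a tree with root label 1 never goes through a node with label 0. *)
Inductive emb : utree -> utree -> Prop :=
| emb_LfLf : emb Lf Lf
| emb_LfUn t : emb Lf (Un t)
| emb_UnUn s t : emb s t -> emb (Un s) (Un t)
| emb_BinBin s1 s2 t1 t2 :
    emb s1 t1 -> emb s2 t2 -> emb (Bin s1 s2) (Bin t1 t2)
| emb_Un s t : nonbin s -> emb s t -> emb s (Un t)
| emb_left s t1 t2 : emb s t1 -> emb s (Bin t1 t2)
| emb_right s t1 t2 : emb s t2 -> emb s (Bin t1 t2).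

Lemma emb_refl t : emb t t.
Proof. by elim: t => *; constructor. Qed.

(** A source [Bin] reaches only targets [Bin]: the one rule that could lead it into a [Un] is
    [emb_Un], whose premise excludes it. *)
Lemma emb_nonbin s t : emb s t -> nonbin t -> nonbin s.
Proof. by case. Qed.

Lemma emb_trans t s u : emb s t -> emb t u -> emb s u.
Proof.
move=> st tu; elim: tu s st => {t u} //.
- by move=> t s st; inversion st; constructor.
- move=> t u _ IH s st; inversion st; subst; constructor => //; exact: IH.
- move=> t1 t2 u1 u2 _ IH1 _ IH2 s st; inversion st; subst.
  + by apply: emb_BinBin; [exact: IH1 | exact: IH2].
  + by apply: emb_left; exact: IH1.
  + by apply: emb_right; exact: IH2.
- by move=> t u nt _ IH s st; apply: emb_Un; [exact: emb_nonbin st nt | exact: IH].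
- by move=> t u1 u2 _ IH s st; apply: emb_left; exact: IH.
- by move=> t u1 u2 _ IH s st; apply: emb_right; exact: IH.
Qed.

Lemma emb_leaf (t : TB) B s :
  is_leaf_label t B -> emb s (utree_of t) -> emb s (graft utree_of B).
Proof.
elim: B => [x /= <- //|B1 IH1 B2 IH2 /= [] h st].
- by apply: emb_left; exact: IH1.
- by apply: emb_right; exact: IH2.
Qed.

Lemma TB_le_emb s t : TB_le s t -> emb (utree_of s) (utree_of t).
Proof.
(* Derivations of [TB_le] are nested in [btree_le TB_le], so [fix] recurses on the derivation, with
   an inner induction on [btree_le] for clause (3). *)
move: s t; fix IH 3 => s t st; case: s t / st.
- by move=> t; exact: emb_refl.
- by move=> s t u st tu; exact: emb_trans (IH _ _ st) (IH _ _ tu).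
- by case=> *; constructor.
- move=> s t B tB st; apply: emb_Un; first exact: nonbin_utree_of.
  exact: emb_leaf tB (IH _ _ st).
- move=> B B' BB'; apply: emb_UnUn.
  elim: BB' => {B B'} /=.
  + by move=> x x'; exact: IH.
  + by move=> *; apply: emb_left.
  + by move=> *; apply: emb_right.
  + by move=> *; apply: emb_BinBin.
Qed.

Lemma btree_le_Leaf (X : Type) (le : X -> X -> Prop) x B :
  btree_le le (Leaf x) B -> exists2 y, is_leaf_label y B & le x y.
Proof.
elim: B => [y|B1 IH1 B2 IH2] h; inversion h; subst; first by exists y.
- by have [//|y yB xy] := IH1; exists y => //; left.
- by have [//|y yB xy] := IH2; exists y => //; right.
Qed.

(** Stated for all trees, read as binary trees over terms, so that the induction can pass through
    [Bin] nodes. *)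
Lemma emb_btree_le s t : emb s t -> btree_le TB_le (btree_of s) (btree_of t).
Proof.
elim=> {s t} /=; try by move=> *; constructor.
- by constructor; constructor.
- by move=> t; constructor; exact: TB_le_circ.
- by move=> s t _ IH; constructor; exact: TB_le_btree.
(* As [s] is [nonbin], [btree_of s] is a single leaf, hence below some label of [btree_of t]; this
   is clause (2). *)
- move=> s t ns _; case: s ns => //= [_|s _] le_st;
  have [y yB xy] := btree_le_Leaf le_st;
  by constructor; exact: TB_le_sub yB xy.
Qed.

Lemma TB_leP s t : TB_le s t <-> emb (utree_of s) (utree_of t).
Proof.
split; first exact: TB_le_emb.
by move=> /emb_btree_le; rewrite !utree_ofK => h; inversion h.
Qed.

(** * Addresses of nodes *)

(* A node is given by its address, where [false] leads to the unique or left
   child and [true] to the right child. *)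
Fixpoint node (t : utree) (p : seq bool) : bool :=
  match t, p with
  | _, [::] => true
  | Lf, _ :: _ => false
  | Un t, b :: p => ~~ b && node t p
  | Bin t1 t2, b :: p => if b then node t2 p else node t1 p
  end.

(** The value is [false] outside the tree, so a binary address is always a node. *)
Fixpoint binary (t : utree) (p : seq bool) : bool :=
  match t, p with
  | Bin _ _, [::] => true
  | Un t, b :: p => ~~ b && binary t p
  | Bin t1 t2, b :: p => if b then binary t2 p else binary t1 p
  | _, _ => false
  end.

Lemma node_nil t : node t [::]. Proof. by case: t. Qed.
#[local] Hint Resolve node_nil : core.

Lemma node_catl t p q : node t (p ++ q) -> node t p.
Proof.
elim: t p => [|t IH|t1 IH1 t2 IH2] [|b p] //=.
  by case/andP=> -> /IH.
by case: b => [/IH2|/IH1].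
Qed.

Lemma node_prefix t p q : prefix p q -> node t q -> node t p.
Proof. by case/prefixP=> r -> /node_catl. Qed.

Lemma node_nonbinary t p b q :
  ~~ binary t p -> node t (p ++ b :: q) -> b = false.
Proof.
elim: t p b => [|t IH|t1 IH1 t2 IH2] [|c p] b //=.
- by move=> _ /andP[] /negbTE.
- by case: c => //=; exact: IH.
- by case: c => /=; [exact: IH2 | exact: IH1].
Qed.

Lemma node_rcons t p b : binary t p -> node t (rcons p b).
Proof.
elim: t p b => [|t IH|t1 IH1 t2 IH2] [|c p] b //=.
- by case/andP=> -> bt; exact: IH.
- by case: b.
- by case: c => bt; [exact: IH2 | exact: IH1].
Qed.

Lemma utree_eq s t :
  node s =1 node t -> (forall p, node s p -> binary s p = binary t p) -> s = t.
Proof.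
elim: s t => [|s IH|s1 IH1 s2 IH2] [|t|t1 t2] // en eb; have := eb [::] isT => //= _.
- by have := en [:: false]; rewrite /= node_nil.
- by have := en [:: false]; rewrite /= node_nil.
- congr Un; apply: IH => [p|p np]; first exact: en (false :: p).
  exact: eb (false :: p) np.
- congr Bin; [apply: IH1 | apply: IH2].
  + by move=> p; exact: en (false :: p).
  + by move=> p; exact: eb (false :: p).
  + by move=> p; exact: en (true :: p).
  + by move=> p; exact: eb (true :: p).
Qed.

(** * Embeddings as maps between addresses *)

(* The immediate successor of a label-0 node has address [rcons p false], hence
   [ae_rcons] expresses both monotonicity and preservation of sides. *)
Record address_embedding (s t : utree) (f : seq bool -> seq bool) : Prop := {
  ae_node : forall p, node s p -> node t (f p);
  ae_binary : forall p, node s p -> binary t (f p) = binary s p;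
  ae_rcons : forall p b, node s (rcons p b) ->
    prefix (rcons (f p) b) (f (rcons p b));
  ae_gap : forall p b q, binary s (rcons p b) -> prefix (rcons (f p) b) q ->
    prefix q (f (rcons p b)) -> binary t q
}.

(** The gap condition in front of the root of [s]: what the gap between a node and its child becomes
    after passing to subtrees. It is vacuous when [s] is [nonbin]. *)
Definition root_gap (s t : utree) (f : seq bool -> seq bool) : Prop :=
  binary s [::] -> forall q, prefix q (f [::]) -> binary t q.

(** Induction on [q] from its last step: [ae_rcons] only extends images, so the direction [b] taken
    at [p] stays visible in the images of all later nodes. *)
Lemma ae_cat s t f p b q : address_embedding s t f -> node s (p ++ b :: q) ->
  prefix (rcons (f p) b) (f (p ++ b :: q)).
Proof.
move=> fP; elim/last_ind: q => [|q c IH].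
  by rewrite cats1; exact: (ae_rcons fP).
rewrite -rcons_cons -rcons_cat => n.
have n' : node s (p ++ b :: q) by apply: node_prefix n; exact: prefix_rcons.
apply: prefix_trans (IH n') _; apply: prefix_trans (ae_rcons fP n).
exact: prefix_rcons.
Qed.

(** Rules that match two roots keep the first step of an address, and descending rules prepend the
    step taken. [root_gap] is carried along because it supplies [ae_gap] for the children of the
    root. *)
Lemma emb_address s t :
  emb s t -> exists2 f, address_embedding s t f & root_gap s t f.
Proof.
elim=> {s t}.
- by exists id => //; split=> // -[|c p] b.
- by move=> t; exists (fun=> [::]) => //; split=> [p|[|b p]|[|c p]|[|c p]].
- move=> s t _ [f fP fg].
  exists (fun p => if p is b :: q then b :: f q else p) => //; split.
  + by case=> //= b p /andP[-> /(ae_node fP)].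
  + by case=> //= b p /andP[-> /(ae_binary fP) ->].
  + case=> [|c p] b /=; first by rewrite eqxx prefix0s.
    by case/andP=> _ /(ae_rcons fP); rewrite eqxx.
  + case=> [|c p] b [|a q] //=.
      by case/andP=> nb bs /andP[/eqP<- _] /andP[_ qp]; rewrite nb fg.
    case/andP=> nc bs /andP[/eqP<- pq] /andP[_ qp].
    by rewrite nc (ae_gap fP bs pq qp).
- move=> s1 s2 t1 t2 _ [f1 f1P f1g] _ [f2 f2P f2g].
  exists (fun p => if p is b :: q then b :: (if b then f2 q else f1 q) else p).
  split.
  + by case=> //= -[] p; exact: ae_node.
  + by case=> //= -[] p; exact: ae_binary.
  + case=> [|c p] b /=; first by rewrite eqxx prefix0s.
    by case: c => /=; [exact: (ae_rcons f2P) | exact: (ae_rcons f1P)].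
  + case=> [|c p] b [|a q] //=.
      by case: b => bs /andP[/eqP<- _] /andP[_ qp] /=; [apply: f2g | apply: f1g].
    by case: c => /= bs /andP[/eqP<- pq] /andP[_ qp];
      [exact: (ae_gap f2P bs pq qp) | exact: (ae_gap f1P bs pq qp)].
  + by move=> _ [].
- move=> s t ns _ [f fP fg]; exists (fun p => false :: f p); last first.
    by move: ns; rewrite /root_gap; case: (s).
  split.
  + by move=> p; exact: (ae_node fP).
  + by move=> p; exact: (ae_binary fP).
  + by move=> p b /=; exact: (ae_rcons fP).
  + by move=> p b [|a q] //= bs /andP[/eqP<-]; exact: (ae_gap fP).
- move=> s t1 t2 _ [f fP fg]; exists (fun p => false :: f p); last first.
    by move=> bs [|a q] //= /andP[/eqP->] /=; exact: fg.
  split.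
  + by move=> p; exact: (ae_node fP).
  + by move=> p; exact: (ae_binary fP).
  + by move=> p b /=; exact: (ae_rcons fP).
  + by move=> p b [|a q] //= bs /andP[/eqP<-]; exact: (ae_gap fP).
- move=> s t1 t2 _ [f fP fg]; exists (fun p => true :: f p); last first.
    by move=> bs [|a q] //= /andP[/eqP->] /=; exact: fg.
  split.
  + by move=> p; exact: (ae_node fP).
  + by move=> p; exact: (ae_binary fP).
  + by move=> p b /=; exact: (ae_rcons fP).
  + by move=> p b [|a q] //= bs /andP[/eqP<-]; exact: (ae_gap fP).
Qed.

Lemma binary_nil t : binary t [::] = ~~ nonbin t. Proof. by case: t. Qed.

Lemma binary_node t p : binary t p -> node t p.
Proof. by move=> /(node_rcons false); apply: node_prefix; exact: prefix_rcons. Qed.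

(** A subtree enters only through its equations for [node] and [binary], so that one lemma serves
    [Un] and both sides of [Bin]. *)
Lemma ae_child s s' b t f : (forall p, node s (b :: p) = node s' p) ->
  (forall p, binary s (b :: p) = binary s' p) ->
  address_embedding s t f -> address_embedding s' t (fun p => f (b :: p)).
Proof.
move=> sn sb fP; split.
- by move=> p; rewrite -sn; exact: (ae_node fP).
- by move=> p; rewrite -sn -sb; exact: (ae_binary fP).
- by move=> p c; rewrite -sn -rcons_cons; exact: (ae_rcons fP).
- by move=> p c q; rewrite -sb -rcons_cons; exact: (ae_gap fP).
Qed.

Lemma ae_behead s t t' b f : (forall p, node t (b :: p) = node t' p) ->
  (forall p, binary t (b :: p) = binary t' p) ->
  (forall p, node s p -> f p = b :: behead (f p)) ->
  address_embedding s t f -> address_embedding s t' (behead \o f).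
Proof.
move=> tn tb fb fP; split=> /=.
- by move=> p n; rewrite -tn -fb //; exact: (ae_node fP).
- by move=> p n; rewrite -tb -fb //; exact: (ae_binary fP).
- move=> p c n; have n' : node s p by apply: node_prefix n; exact: prefix_rcons.
  by have := ae_rcons fP n; rewrite (fb _ n) (fb _ n') /= eqxx.
- move=> p c q bs pq qp; rewrite -tb; have n := binary_node bs.
  have n' : node s p by apply: node_prefix n; exact: prefix_rcons.
  by apply: (ae_gap fP bs); [rewrite (fb _ n') | rewrite (fb _ n)]; rewrite /= eqxx.
Qed.

(** When the root goes to the root, [ae_cat] forces the subtree of [s] in direction [b] into that of
    [t], and the gap between root and child turns into a [root_gap]. *)
Lemma ae_behead_child s s' t t' b f :
  (forall p, node s (b :: p) = node s' p) ->
  (forall p, binary s (b :: p) = binary s' p) ->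
  (forall p, node t (b :: p) = node t' p) ->
  (forall p, binary t (b :: p) = binary t' p) ->
  f [::] = [::] -> address_embedding s t f ->
  address_embedding s' t' (behead \o (fun p => f (b :: p))) /\
  root_gap s' t' (behead \o (fun p => f (b :: p))).
Proof.
move=> sn sb tn tb f0 fP.
have fb p : node s' p -> f (b :: p) = b :: behead (f (b :: p)).
  rewrite -sn -[b :: p]cat0s => /(ae_cat fP) /=; rewrite f0.
  by case: (f (b :: p)) => //= c r /andP[/eqP<-].
split; first by apply: (ae_behead tn tb fb); exact: ae_child sn sb fP.
rewrite /root_gap -sb => bs q /= qp; rewrite -tb.
have n : node s' [::] by exact: node_nil.
apply: (ae_gap (p := [::]) fP bs); last by rewrite (fb _ n) /= eqxx.
by rewrite f0 /= eqxx prefix0s.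
Qed.

Lemma ae_cons s t b r f : f [::] = b :: r -> address_embedding s t f ->
  forall p, node s p -> f p = b :: behead (f p).
Proof.
move=> f0 fP [|c p] n; first by rewrite f0.
have := ae_cat (p := [::]) fP n; rewrite f0 /=.
by case: (f (c :: p)) => //= a q /andP[/eqP->].
Qed.

Lemma root_gap_behead s t t' b r f : f [::] = b :: r ->
  (forall p, binary t (b :: p) = binary t' p) ->
  root_gap s t f -> root_gap s t' (behead \o f).
Proof.
move=> f0 tb fg bs q /=; rewrite f0 /= => qr; rewrite -tb.
by apply: fg => //; rewrite f0 /= eqxx.
Qed.

(** Induction on [t]; the image of the root of [s] selects the rule. If it is the root, two roots
    are matched; otherwise the first step of [f [::]] tells which subtree receives all of [s]. *)
Lemma address_emb s t f : address_embedding s t f -> root_gap s t f -> emb s t.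
Proof.
elim: t s f => [|t IH|t1 IH1 t2 IH2] s f fP fg;
  have := ae_node fP (node_nil s); have := ae_binary fP (node_nil s);
  case f0: (f [::]) => [|b r] //=; rewrite binary_nil.
- case: s fP {fg} => [|s|//] fP _ _; first by constructor.
  (* The child of [Un s] would need an image strictly above the root of [Lf]. *)
  have n : node (Un s) (rcons [::] false) by exact: node_nil.
  by have := ae_rcons fP n; have := ae_node fP n; rewrite f0; case: (f _).
- case: s fP {fg} => [|s|//] fP _ _; constructor.
  by have [] :=
      @ae_behead_child (Un s) s (Un t) t false f; last exact: IH.
- move=> _ /andP[nb _]; move: nb f0; case: b => // _ f0.
  apply: emb_Un; last first.
    apply: (IH _ (behead \o f)); last exact: root_gap_behead f0 _ fg.
    by apply: (ae_behead (b := false) _ _ (ae_cons f0 fP) fP).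
  (* If [s] had a binary root, [root_gap] at [[::]] would make the root of [Un t] binary. *)
  by apply: contraT; rewrite -binary_nil => /fg /(_ [::]); rewrite prefix0s => /(_ isT).
- case: s fP {fg} => // s1 s2 fP _ _; constructor.
  + by have [] :=
      @ae_behead_child (Bin s1 s2) s1 (Bin t1 t2) t1 false f; last exact: IH1.
  + by have [] :=
      @ae_behead_child (Bin s1 s2) s2 (Bin t1 t2) t2 true f; last exact: IH2.
- move=> _ _; case: b f0 => f0; [apply: emb_right | apply: emb_left].
  + apply: (IH2 _ (behead \o f)); last exact: root_gap_behead f0 _ fg.
    by apply: (ae_behead (b := true) _ _ (ae_cons f0 fP) fP).
  + apply: (IH1 _ (behead \o f)); last exact: root_gap_behead f0 _ fg.
    by apply: (ae_behead (b := false) _ _ (ae_cons f0 fP) fP).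
Qed.

(** * The structured tree formed by the addresses of a term *)

Fixpoint addresses (t : utree) : seq (seq bool) :=
  match t with
  | Lf => [:: [::]]
  | Un t => [::] :: map (cons false) (addresses t)
  | Bin t1 t2 =>
      [::] :: map (cons false) (addresses t1) ++ map (cons true) (addresses t2)
  end.

Lemma mem_map_cons (b c : bool) p (s : seq (seq bool)) :
  (b :: p \in map (cons c) s) = (b == c) && (p \in s).
Proof.
apply/mapP/andP => [[q qs [-> ->]]|[/eqP-> ps]]; first by rewrite eqxx.
by exists p.
Qed.

Lemma mem_addresses t p : (p \in addresses t) = node t p.
Proof.
elim: t p => [|t IH|t1 IH1 t2 IH2] [|b p] //=; rewrite in_cons /=.
- by rewrite mem_map_cons IH; case: b.
- by rewrite mem_cat !mem_map_cons IH1 IH2; case: b; rewrite ?orbF.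
Qed.

Lemma prefix_anti : antisymmetric (@prefix bool).
Proof.
move=> p q /andP[pq qp]; apply/eqP; move: pq; rewrite prefixE.
by rewrite take_oversize ?(size_prefix qp) // eq_sym.
Qed.

Lemma prefix_total (p q r : seq bool) :
  prefix p r -> prefix q r -> prefix p q || prefix q p.
Proof.
elim: r p q => [|a r IH] [|b p] [|c q] //= /andP[/eqP-> pr] /andP[/eqP-> qr].
by rewrite eqxx /=; exact: IH.
Qed.

Definition tnode (t : utree) : Type := seq_sub (addresses t).

HB.instance Definition _ t := Finite.on (tnode t).
HB.instance Definition _ t := SubType.on (tnode t).

Definition addr t (x : tnode t) : seq bool := val x.

Lemma node_addr t (x : tnode t) : node t (addr x).
Proof. by rewrite -mem_addresses; exact: valP. Qed.
#[local] Hint Resolve node_addr : core.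

Lemma addr_inj t : injective (@addr t).
Proof. exact: val_inj. Qed.

Definition troot t : tnode t :=
  SeqSub (etrans (mem_addresses t [::]) (node_nil t)).

Definition tnode_at t (p : seq bool) : tnode t := insubd (troot t) p.

Lemma addr_at t p : node t p -> addr (tnode_at t p) = p.
Proof. by move=> n; rewrite /addr /tnode_at val_insubd mem_addresses n. Qed.

Definition tle t (x y : tnode t) : bool := prefix (addr x) (addr y).

Lemma tle_refl t : reflexive (@tle t).
Proof. by move=> x; exact: prefix_refl. Qed.

Lemma tle_anti t : antisymmetric (@tle t).
Proof. by move=> x y /prefix_anti /addr_inj. Qed.

Lemma tle_trans t : transitive (@tle t).
Proof. by move=> y x z; exact: prefix_trans. Qed.

Lemma tle0x t x : tle (troot t) x.
Proof. exact: prefix0s. Qed.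

Fact tnode_display : Order.disp_t. Proof. exact: (Order.Disp tt tt). Qed.

HB.instance Definition _ t :=
  Order.Le_isPOrder.Build tnode_display (tnode t) (@tle_refl t) (@tle_anti t)
    (@tle_trans t).
HB.instance Definition _ t :=
  Order.hasBottom.Build tnode_display (tnode t) (@tle0x t).

Local Open Scope order_scope.

Lemma tleE t (x y : tnode t) : (x <= y) = prefix (addr x) (addr y).
Proof. by []. Qed.

Lemma addr_bot t : addr (\bot : tnode t) = [::].
Proof. by []. Qed.

Lemma tltP t (x y : tnode t) :
  x < y <-> exists b q, addr y = addr x ++ b :: q.
Proof.
rewrite lt_def tleE; split.
  case/andP=> xy /prefixP[[|b q] e]; last by exists b, q.
  by case/eqP: xy; apply: addr_inj; rewrite e cats0.
case=> b [q e]; rewrite e prefix_prefix andbT; apply/eqP => yx.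
move/(congr1 size): e; rewrite yx size_cat => /eqP.
by rewrite -[X in X == _]addn0 eqn_add2l.
Qed.

Lemma timmediateP t (x y : tnode t) :
  immediate_succ x y <-> exists b, addr y = rcons (addr x) b.
Proof.
split=> [[/tltP[b [[|c q] e]] h]|[b e]]; first by exists b; rewrite e cats1.
  (* If [y] is two or more steps above [x], the node after the first step lies strictly between
     them. *)
  have n : node t (rcons (addr x) b).
    by apply: node_prefix (node_addr y); rewrite e -cat_rcons prefix_prefix.
  case: (h (tnode_at t (rcons (addr x) b))); split; apply/tltP; rewrite addr_at //.
    by exists b, [::]; rewrite cats1.
  by exists c, q; rewrite e cat_rcons.
split; first by apply/tltP; exists b, [::]; rewrite e cats1.
(* Two nonempty extensions cannot add up to a single step. *)
move=> z [/tltP[c [q ez]] /tltP[d [r]]].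
rewrite e ez -cats1 -catA => /(congr1 size); rewrite !size_cat.
by move/eqP; rewrite eqn_add2l /= addnS addSn.
Qed.

Definition tlabel t (x : tnode t) : 'I_2 :=
  if binary t (addr x) then ord_max else ord0.

Lemma tlabelE t (x : tnode t) : tlabel x = binary t (addr x) :> nat.
Proof. by rewrite /tlabel; case: binary. Qed.

Lemma tchain t (x y z : tnode t) : y <= x -> z <= x -> y >=< z.
Proof. by rewrite !tleE; exact: prefix_total. Qed.

Definition ltree_of (t : utree) : ltree 2 := LTree (@tlabel t) (@tchain t).

(** Where this child does not exist, [tnode_at] defaults to the root; this happens only at label-0
    nodes, where the choice of successors is irrelevant. *)
Definition tchild t (b : bool) (x : tnode t) : tnode t :=
  tnode_at t (rcons (addr x) b).

Lemma addr_child t b (x : tnode t) : node t (rcons (addr x) b) ->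
  addr (tchild b x) = rcons (addr x) b.
Proof. exact: addr_at. Qed.

Lemma troot_label t : nonbin t -> label (\bot : ltree_of t) = 0 :> nat.
Proof. by move=> nt; rewrite tlabelE addr_bot binary_nil nt. Qed.

Lemma tsucc0 t (x y z : ltree_of t) : label x = 0 :> nat ->
  immediate_succ x y -> immediate_succ x z -> y = z.
Proof.
rewrite tlabelE => /eqP; rewrite eqb0 => nb.
move=> /timmediateP[b ey] /timmediateP[c ez]; apply: addr_inj.
have := node_addr y; have := node_addr z; rewrite ey ez -!cats1.
by move=> /(node_nonbinary nb)-> /(node_nonbinary nb)->.
Qed.

Lemma tsucc1 t (x : ltree_of t) : label x = 1 :> nat ->
  tchild false x <> tchild true x /\
  forall y, immediate_succ x y <-> y = tchild false x \/ y = tchild true x.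
Proof.
rewrite tlabelE => /eqP; rewrite eqb1 => bx; split.
  move/(congr1 (@addr t)); rewrite !addr_child ?node_rcons //.
  by move/rcons_inj => -[].
move=> y; rewrite timmediateP; split.
  by case=> -[] e; [right | left]; apply: addr_inj; rewrite addr_child ?node_rcons.
by case=> ->; eexists; rewrite addr_child ?node_rcons.
Qed.

Definition stree_of (s : TB) : stree :=
  STree (troot_label (nonbin_utree_of s)) (@tsucc0 _) (@tsucc1 (utree_of s)).

(** * Gap embeddings of address trees *)

Lemma prefix_next (p q r : seq bool) b c :
  prefix (rcons p b) r -> prefix (p ++ c :: q) r -> c = b.
Proof.
elim: p r => [|a p IH] [|d r] //=; first by move=> /andP[/eqP-> _] /andP[/eqP->].
by move=> /andP[_ pr] /andP[_]; exact: IH.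
Qed.

Lemma prefix_fork (r p q w : seq bool) b :
  prefix w (r ++ b :: p) -> prefix w (r ++ ~~ b :: q) -> prefix w r.
Proof.
elim: r w => [|a r IH] [|d w] //=.
  by move=> /andP[/eqP-> _] /andP[/eqP]; case: b.
by move=> /andP[/eqP-> wp] /andP[_ wq]; rewrite eqxx; exact: IH wp wq.
Qed.

(** This case split computes infima: the smaller node in the first two cases, the fork [r] in the
    third. *)
Lemma prefix_or_fork (p q : seq bool) :
  [\/ prefix p q, prefix q p |
      exists r b p' q', p = r ++ b :: p' /\ q = r ++ ~~ b :: q'].
Proof.
elim: p q => [|a p IH] [|c q]; try by [constructor 1 | constructor 2].
have [<-{c}|/eqP ac] := eqVneq a c; last first.
  by constructor 3; exists [::], a, p, q; case: a c ac => [] [].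
case: (IH q) => [pq|qp|[r [b [p' [q' [-> ->]]]]]].
- by constructor 1; rewrite /= eqxx.
- by constructor 2; rewrite /= eqxx.
- by constructor 3; exists (a :: r), b, p', q'.
Qed.

Lemma is_infC (d : Order.disp_t) (T : porderType d) (x y z : T) :
  is_inf x y z -> is_inf y x z.
Proof. by case=> zx zy h; split=> // w wy wx; exact: h. Qed.

Lemma is_inf_le (d : Order.disp_t) (T : porderType d) (x y z : T) :
  x <= y -> is_inf x y z <-> z = x.
Proof.
move=> xy; split=> [[zx _ h]|->]; last by split.
by apply/eqP; rewrite eq_le zx h.
Qed.

Lemma is_inf_fork t (x y z : tnode t) r b p q :
  addr x = r ++ b :: p -> addr y = r ++ ~~ b :: q ->
  is_inf x y z <-> addr z = r.
Proof.
move=> ex ey; have nr : node t r.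
  by apply: node_prefix (node_addr x); rewrite ex prefix_prefix.
split=> [[]|ez].
  rewrite !tleE ex ey => zx zy /(_ (tnode_at t r)).
  rewrite !tleE addr_at // ex ey !prefix_prefix => /(_ isT isT) rz.
  by apply: prefix_anti; rewrite rz (prefix_fork zx zy).
split; rewrite ?tleE ?ez ?ex ?ey ?prefix_prefix // => w.
by rewrite !tleE ex ey ez; exact: prefix_fork.
Qed.

(** Preservation of infima comes from [ae_cat]: nodes that fork at [z] have images on different
    sides of [g z], so these fork at [g z]. *)
Lemma address_stree_le s t f :
  address_embedding (utree_of s) (utree_of t) f ->
  stree_le (stree_of s) (stree_of t).
Proof.
move=> fP; pose g (x : tnode (utree_of s)) := tnode_at (utree_of t) (f (addr x)).
have gE x : addr (g x) = f (addr x) by rewrite addr_at //; exact: ae_node fP _ _.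
have g_cat x y b q : addr y = addr x ++ b :: q ->
    prefix (rcons (addr (g x)) b) (addr (g y)).
  by move=> e; rewrite !gE e; apply: (ae_cat fP); rewrite -e.
have g_le x y : x <= y -> g x <= g y.
  rewrite le_eqVlt => /predU1P[->//|/tltP[b [q /g_cat]]].
  by rewrite tleE; apply: prefix_trans; exact: prefix_rcons.
have g_inf x y z : is_inf x y z -> is_inf (g x) (g y) (g z).
  case: (prefix_or_fork (addr x) (addr y)) => [xy|yx|[r [b [p [q [ex ey]]]]]].
  - by move/(is_inf_le _ (xy : x <= y)) ->; apply/is_inf_le => //; exact: g_le.
  - move/is_infC/(is_inf_le _ (yx : y <= x)) ->; apply: is_infC.
    by apply/is_inf_le => //; exact: g_le.
  - move/(is_inf_fork _ ex ey) => ez.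
    move: ex ey; rewrite -ez => /g_cat/prefixP[p' +] /g_cat/prefixP[q' +].
    by rewrite !cat_rcons => ex ey; apply/(is_inf_fork _ ex ey).
have g_child b (x y : tnode (utree_of s)) : binary (utree_of s) (addr x) ->
    tchild b x <= y -> tchild b (g x) <= g y.
  move=> bx; rewrite !tleE !addr_child ?node_rcons //; last first.
    by rewrite gE (ae_binary fP).
  by case/prefixP=> q; rewrite cat_rcons; exact: g_cat.
exists g; split; first split.
- move=> x y e; case: (prefix_or_fork (addr x) (addr y)) => [xy|yx|].
  + move: xy; rewrite -tleE le_eqVlt => /predU1P[//|/tltP[b [q /g_cat]]].
    by rewrite e => /size_prefix; rewrite size_rcons ltnn.
  + move: yx; rewrite -tleE le_eqVlt => /predU1P[//|/tltP[b [q /g_cat]]].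
    by rewrite e => /size_prefix; rewrite size_rcons ltnn.
  (* Both images extend that of [r], but in different directions, so they differ. *)
  + case=> [r [b [p [q [ex ey]]]]].
    have nr : node (utree_of s) r.
      by apply: node_prefix (node_addr x); rewrite ex prefix_prefix.
    have := ae_cat fP (etrans (congr1 _ (esym ex)) (node_addr x)).
    have := ae_cat fP (etrans (congr1 _ (esym ey)) (node_addr y)).
    rewrite -ex -ey -!gE e => h; rewrite -cats1 => /(prefix_next h).
    by case: (b).
- exact: g_le.
- exact: g_inf.
- by move=> x; rewrite /= /tlabel gE (ae_binary fP).
- move=> x y z /timmediateP[b ey] /tltP[c [q ez]] /ltW zy.
  (* If [g y] has label 0 the inequality is trivial; otherwise [ae_gap] applies. *)
  rewrite /= !tlabelE; case: (boolP (binary _ (addr (g y)))) => //.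
  rewrite gE (ae_binary fP) // ey => bs.
  have n : node (utree_of s) (rcons (addr x) b) by rewrite -ey.
  move: zy; rewrite tleE gE ey => zy.
  rewrite (ae_gap fP bs _ zy) //; have := ae_rcons fP n; rewrite ez gE in zy *.
  by move=> h; rewrite (prefix_next h zy) -cat_rcons prefix_prefix.
- by move=> x y /=; rewrite tlabelE => /eqP; rewrite eqb1; exact: g_child.
- by move=> x y /=; rewrite tlabelE => /eqP; rewrite eqb1; exact: g_child.
Qed.

(** At a binary node the conditions on [lsucc] and [rsucc] fix the direction of a child; elsewhere
    [false] is the only direction in both trees, and strict monotonicity suffices. *)
Lemma stree_le_address s t : stree_le (stree_of s) (stree_of t) ->
  exists f, address_embedding (utree_of s) (utree_of t) f.
Proof.
case=> g [[g_inj g_le _ g_label g_gap] g_left g_right].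
have g_bin (x : tnode (utree_of s)) :
    binary (utree_of t) (addr (g x)) = binary (utree_of s) (addr x).
  have := congr1 val (g_label x); rewrite /= [LHS]tlabelE [RHS]tlabelE.
  by do 2!case: binary.
pose at_s := tnode_at (utree_of s).
have g_rcons p b : node (utree_of s) (rcons p b) ->
    prefix (rcons (addr (g (at_s p))) b) (addr (g (at_s (rcons p b)))).
  move=> n; have n' : node (utree_of s) p.
    by apply: node_prefix n; exact: prefix_rcons.
  have e : addr (at_s p) = p by exact: addr_at.
  case: (boolP (binary (utree_of s) p)) => bp.
    have l1 : @label _ (stree_of s) (at_s p) = 1 :> nat by rewrite tlabelE e bp.
    have : tchild b (at_s p) <= at_s (rcons p b) by rewrite /tchild e.
    have -> : prefix (rcons (addr (g (at_s p))) b)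
                     (addr (g (at_s (rcons p b)))) =
        (tchild b (g (at_s p)) <= g (at_s (rcons p b))).
      by rewrite tleE addr_child // node_rcons // g_bin e.
    by case: (b); [exact: g_right | exact: g_left].
  have b0 : b = false by apply: node_nonbinary bp _; rewrite -cats1 in n; exact: n.
  have : at_s p < at_s (rcons p b).
    by apply/tltP; exists b, [::]; rewrite !addr_at // cats1.
  rewrite lt_def => /andP[ne /g_le le_g].
  have /tltP[c [q eg]] : g (at_s p) < g (at_s (rcons p b)).
    by rewrite lt_def le_g andbT; apply: contra_neq ne => /g_inj.
  rewrite eg; have := node_addr (g (at_s (rcons p b))); rewrite eg.
  move/node_nonbinary => -> //; last by rewrite g_bin e.
  by rewrite b0 -cat_rcons prefix_prefix.
exists (fun p => addr (g (at_s p))); split=> //.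
- by move=> p n; rewrite g_bin addr_at.
- move=> p b q bs /prefixP[r eq_q] qy; have n := binary_node bs.
  have n' : node (utree_of s) p by apply: node_prefix n; exact: prefix_rcons.
  (* [ae_gap] includes the endpoint, which the gap condition omits; there preservation of labels
     decides. *)
  have [->|ne] := eqVneq q (addr (g (at_s (rcons p b)))).
    by rewrite g_bin addr_at.
  have nq : node (utree_of t) q by apply: node_prefix qy _.
  have := g_gap (at_s p) (at_s (rcons p b)) (tnode_at _ q).
  rewrite /= !tlabelE g_bin !addr_at // bs.
  case: (binary (utree_of t) q) => // h; apply: h.
  + by apply/timmediateP; exists b; rewrite !addr_at.
  + by apply/tltP; exists b, r; rewrite addr_at // eq_q cat_rcons.
  + rewrite lt_def tleE addr_at // qy andbT; apply: contra_neq ne => ->.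
    by rewrite addr_at.
Qed.

Lemma stree_of_le s t : TB_le s t <-> stree_le (stree_of s) (stree_of t).
Proof.
rewrite TB_leP; split=> [/emb_address[f fP _]|/stree_le_address[f fP]].
  exact: address_stree_le fP.
(* The root of a term has label 0, so [root_gap] is vacuous. *)
by apply: address_emb fP _; rewrite /root_gap binary_nil nonbin_utree_of.
Qed.

(** * Isomorphisms of structured trees *)

Lemma inj_surj_bij (A B : Type) (f : A -> B) :
  injective f -> (forall y, exists x, f x = y) -> bijective f.
Proof.
move=> f_inj f_surj; exists (fun y => projT1 (cid (f_surj y))) => [x|y].
  by apply: f_inj; exact: projT2 (cid (f_surj (f x))).
exact: projT2 (cid (f_surj y)).
Qed.

Section Isomorphisms.
Variables (d1 d2 : Order.disp_t) (T1 : porderType d1) (T2 : porderType d2).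
Variable f : T1 -> T2.
Hypotheses (f_bij : bijective f) (f_le : forall x y, (f x <= f y) = (x <= y)).

Lemma iso_lt x y : (f x < f y) = (x < y).
Proof. by rewrite !lt_def f_le (bij_eq f_bij). Qed.

Lemma iso_immediate_succ x y : immediate_succ x y -> immediate_succ (f x) (f y).
Proof.
case=> xy h; split=> [|z]; first by rewrite iso_lt.
by case: f_bij => g _ fK; rewrite -[z]fK !iso_lt; exact: h.
Qed.

Lemma iso_is_inf x y z : is_inf x y z -> is_inf (f x) (f y) (f z).
Proof.
case=> zx zy h; split; rewrite ?f_le // => w.
by case: f_bij => g _ fK; rewrite -[w]fK !f_le; exact: h.
Qed.

End Isomorphisms.

Lemma stree_iso_refl T : stree_iso T T.
Proof. by exists id; split=> //; exists id. Qed.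

Lemma stree_iso_sym T1 T2 : stree_iso T1 T2 -> stree_iso T2 T1.
Proof.
case=> f [[g fK gK] f_le f_label f_succ]; have g_label x : label (g x) = label x.
  by rewrite -f_label gK.
exists g; split=> [|x y|//|x lx]; first by exists f.
  by rewrite -f_le !gK.
have [] := f_succ (g x); first by rewrite g_label.
by rewrite gK => <- <-; rewrite !fK.
Qed.

Lemma stree_iso_trans T1 T2 T3 :
  stree_iso T1 T2 -> stree_iso T2 T3 -> stree_iso T1 T3.
Proof.
case=> f [f_bij f_le f_label f_succ] [g [g_bij g_le g_label g_succ]].
exists (g \o f); split=> [|x y|x|x lx] /=; first exact: bij_comp.
- by rewrite g_le.
- by rewrite g_label.
have [-> ->] := f_succ x lx.
by have [-> ->] := g_succ (f x) (etrans (congr1 _ (f_label x)) lx).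
Qed.

(** [Tbar2_le] speaks of some representatives; composition with isomorphisms, here on the right and
    next on the left, transfers embeddings to any others. *)
Lemma stree_le_isor T1 T2 T3 :
  stree_le T1 T2 -> stree_iso T2 T3 -> stree_le T1 T3.
Proof.
case=> f [[f_inj f_le f_inf f_label f_gap] f_left f_right].
case=> g [g_bij g_le g_label g_succ].
have fl x : label x = 1 :> nat -> label (f x) = 1 :> nat by rewrite -f_label.
exists (g \o f); split; first split=> /=.
- by apply: inj_comp => //; exact: bij_inj.
- by move=> x y /f_le; rewrite g_le.
- by move=> x y z /f_inf; exact: iso_is_inf.
- by move=> x; rewrite g_label.
- case: (g_bij) => h _ gK x y z xy; rewrite -[z]gK !(iso_lt g_bij g_le) !g_label.
  exact: f_gap.
- move=> x y lx /(f_left _ _ lx); rewrite -g_le.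
  by have [-> _] := g_succ _ (fl _ lx).
- move=> x y lx /(f_right _ _ lx); rewrite -g_le.
  by have [_ ->] := g_succ _ (fl _ lx).
Qed.

Lemma stree_le_isol T1 T2 T3 :
  stree_iso T1 T2 -> stree_le T2 T3 -> stree_le T1 T3.
Proof.
case=> g [g_bij g_le g_label g_succ].
case=> f [[f_inj f_le f_inf f_label f_gap] f_left f_right].
have gl x : label x = 1 :> nat -> label (g x) = 1 :> nat by rewrite g_label.
exists (f \o g); split; first split=> /=.
- by apply: inj_comp => //; exact: bij_inj.
- by move=> x y; rewrite -g_le; exact: f_le.
- by move=> x y z h; apply/f_inf/iso_is_inf.
- by move=> x; rewrite -g_label.
- by move=> x y z xy; apply: f_gap; exact: iso_immediate_succ.
- move=> x y lx; rewrite -g_le; have [-> _] := g_succ _ lx.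
  by apply: f_left; exact: gl.
- move=> x y lx; rewrite -g_le; have [_ ->] := g_succ _ lx.
  by apply: f_right; exact: gl.
Qed.

(** Address trees are rigid: by induction on the address from its last step, an isomorphism keeps
    the address of every node, and nodes with their labels determine the term. *)
Lemma stree_of_iso_inj s t : stree_iso (stree_of s) (stree_of t) -> s = t.
Proof.
case=> f [f_bij f_le f_label f_succ].
have f_bin (x : tnode (utree_of s)) :
    binary (utree_of t) (addr (f x)) = binary (utree_of s) (addr x).
  have := congr1 val (f_label x); rewrite /= [LHS]tlabelE [RHS]tlabelE.
  by do 2!case: binary.
have f_addr : forall x, addr (f x) = addr x.
  suff h p : forall x, addr x = p -> addr (f x) = p by move=> x; exact: h.
  elim/last_ind: p => [|p b IH] x ex.
    have -> : x = \bot by exact: addr_inj.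
    case: f_bij => g _ fK; have := le0x (g \bot); rewrite -f_le fK.
    by rewrite [_ <= _]tleE addr_bot; case: (addr _).
  have n : node (utree_of s) p.
    by apply: node_prefix (node_addr x); rewrite ex; exact: prefix_rcons.
  pose y : stree_of s := tnode_at _ p; have ey : addr y = p by exact: addr_at.
  have fy : addr (f y) = p by exact: IH.
  have xy : immediate_succ y x by apply/timmediateP; exists b; rewrite ey.
  have [c ec] := (timmediateP _ _).1 (iso_immediate_succ f_bij f_le xy).
  have [bp|bp] := boolP (binary (utree_of s) p).
    have ly : label y = 1 :> nat by rewrite tlabelE ey bp.
    have -> : x = tchild b y by apply: addr_inj; rewrite addr_child ey // node_rcons.
    have -> : f (tchild b y) = tchild b (f y) :> tnode _.
      by have [] := f_succ y ly; case: (b).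
    by rewrite addr_child fy // node_rcons // -fy f_bin ey.
  (* Above a node that is not binary, both [b] and [c] can only be [false]. *)
  have := node_addr x; rewrite ex -cats1 => /(node_nonbinary bp) ->.
  have := node_addr (f x); rewrite ec fy -!cats1 => /node_nonbinary -> //.
  by rewrite -fy f_bin ey.
apply: utree_of_inj; apply: utree_eq => [p|p n].
  apply/idP/idP => n.
    by rewrite -(addr_at n) -f_addr node_addr.
  case: f_bij => g _ fK.
  by rewrite -(addr_at n) -[tnode_at _ p]fK f_addr node_addr.
by have := f_bin (tnode_at _ p); rewrite f_addr addr_at // => ->.
Qed.

(** * Every structured tree comes from a term *)

Section Coding.
Variable T : stree.

(** Induction on the number of nodes below [y]: a node strictly between [x] and [y] replaces [y]. *)
Lemma exists_immediate_succ (x y : T) :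
  x < y -> exists2 z, immediate_succ x z & z <= y.
Proof.
have [n] := ubnP #|[set w | w < y]|;
  elim: n y => // n IH y; rewrite ltnS => le_n xy.
have [/existsP[w /andP[xw wy]]|/existsPn none] :=
  boolP [exists w, (x < w) && (w < y)].
  have [||z xz zw] := IH w => //; last by exists z => //; exact: le_trans zw (ltW wy).
  apply: leq_trans le_n; apply: proper_card; apply/properP; split.
    by apply/subsetP=> v; rewrite !inE => /lt_trans; exact.
  by exists w; rewrite !inE ?ltxx.
exists y => //; split=> // z [xz zy]; have := none z; by rewrite xz zy.
Qed.

(* [f] maps the addresses of [t] to the nodes of [T] above [x]. *)
Record coding (x : T) (t : utree) (f : seq bool -> T) : Prop := {
  coding_nil : f [::] = x;
  coding_le : forall p q, node t p -> node t q -> (f p <= f q) = prefix p q;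
  coding_surj : forall y, x <= y -> exists2 p, node t p & f p = y;
  coding_label : forall p, node t p -> label (f p) = binary t p :> nat;
  coding_succ : forall p, binary t p ->
    f (rcons p false) = lsucc (f p) /\ f (rcons p true) = rsucc (f p)
}.

Lemma coding_ge x t f p : coding x t f -> node t p -> x <= f p.
Proof.
by move=> fP n; rewrite -(coding_nil fP) (coding_le fP) ?prefix0s ?node_nil.
Qed.

Lemma coding_Lf x : label x = 0 :> nat -> (forall y, ~~ (x < y)) ->
  coding x Lf (fun=> x).
Proof.
move=> lx x_max; split=> //.
- by case=> // -[] // _ _; rewrite lexx.
- move=> y; rewrite le_eqVlt => /orP[/eqP <-|xy]; first by exists [::].
  by have := x_max y; rewrite xy.
Qed.

Lemma coding_Un x y t f : label x = 0 :> nat -> immediate_succ x y ->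
  coding y t f -> coding x (Un t) (fun p => if p is _ :: q then f q else x).
Proof.
move=> lx xy fP; have lt_x p : node t p -> x < f p.
  by move=> n; apply: lt_le_trans (coding_ge fP n); case: xy.
split=> //.
- case=> [|b p] [|c q] //=; rewrite ?lexx //.
  + by move=> _ /andP[_ /lt_x/ltW].
  + by move=> /andP[_ /lt_x/lt_geF].
  + by move=> /andP[/negbTE-> np] /andP[/negbTE-> nq]; exact: (coding_le fP).
- move=> z; rewrite le_eqVlt => /orP[/eqP <-|xz]; first by exists [::].
  have [y' xy' y'z] := exists_immediate_succ xz.
  (* All nodes strictly above [x] lie above its unique immediate successor. *)
  rewrite (stree_succ0 lx xy' xy) in y'z.
  by have [p n <-] := coding_surj fP y'z; exists (false :: p).
- by case=> [|b p] //= /andP[-> n]; exact: (coding_label fP).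
- by case=> [|b p] //= /andP[_ n]; exact: (coding_succ fP).
Qed.

Lemma coding_Bin x t1 t2 f1 f2 : label x = 1 :> nat ->
  coding (lsucc x) t1 f1 -> coding (rsucc x) t2 f2 ->
  coding x (Bin t1 t2)
    (fun p => if p is b :: q then if b then f2 q else f1 q else x).
Proof.
move=> lx f1P f2P; have [ne imm] := stree_succ1 lx.
have il : immediate_succ x (lsucc x) by apply/imm; left.
have ir : immediate_succ x (rsucc x) by apply/imm; right.
have lt1 p : node t1 p -> x < f1 p.
  by move=> n; apply: lt_le_trans (coding_ge f1P n); case: il.
have lt2 p : node t2 p -> x < f2 p.
  by move=> n; apply: lt_le_trans (coding_ge f2P n); case: ir.
(* A common upper bound would make the two successors comparable by the chain condition; being
   distinct, one would lie strictly between [x] and the other. *)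
have disj y : lsucc x <= y -> rsucc x <= y -> False.
  move=> ly ry; have := ltree_chain ly ry; rewrite /Order.comparable.
  rewrite !le_eqVlt => /orP[/orP[/eqP//|lr]|/orP[/eqP/esym//|rl]].
    by case: ir => _ /(_ (lsucc x)); apply; split=> //; case: il.
  by case: il => _ /(_ (rsucc x)); apply; split=> //; case: ir.
split=> //.
- case=> [|b p] [|c q] //=; rewrite ?lexx //.
  + by case: c => _ => [/lt2/ltW|/lt1/ltW].
  + by case: b => [/lt2/lt_geF|/lt1/lt_geF].
  + case: b c => [] [] np nq /=.
    * exact: (coding_le f2P).
    * apply/negbTE/negP => le21; apply: (disj (f1 q)).
        exact: coding_ge f1P nq.
      exact: le_trans (coding_ge f2P np) le21.
    * apply/negbTE/negP => le12; apply: (disj (f2 q)).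
        exact: le_trans (coding_ge f1P np) le12.
      exact: coding_ge f2P nq.
    * exact: (coding_le f1P).
- move=> z; rewrite le_eqVlt => /orP[/eqP <-|xz]; first by exists [::].
  have [y /imm[]-> yz] := exists_immediate_succ xz.
    by have [p n <-] := coding_surj f1P yz; exists (false :: p).
  by have [p n <-] := coding_surj f2P yz; exists (true :: p).
- case=> [|[] p] //= n; [exact: (coding_label f2P) | exact: (coding_label f1P)].
- case=> [|[] p] /= n; first by rewrite (coding_nil f1P) (coding_nil f2P).
    exact: (coding_succ f2P).
  exact: (coding_succ f1P).
Qed.

(** Induction on the number of nodes above [x], itself included; an immediate successor loses at
    least [x]. *)
Lemma exists_coding x : exists t f, coding x t f.
Proof.
have [n] := ubnP #|[set y | x <= y]|;
  elim: n x => // n IH x; rewrite ltnS => le_n.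
have {}IH y : immediate_succ x y -> exists t f, coding y t f.
  case=> xy _; apply: IH; apply: leq_trans le_n; apply: proper_card.
  apply/properP; split.
    by apply/subsetP=> v; rewrite !inE => /(le_trans (ltW xy)).
  by exists x; rewrite !inE ?lexx // lt_geF.
have [lx|lx] : label x = 0 :> nat \/ label x = 1 :> nat.
  by case: (label x) => -[|[|]] //; [left | right].
- have [/existsP[y /exists_immediate_succ[z xz _]]|/existsPn none] :=
    boolP [exists y, x < y].
    have [t [f fP]] := IH z xz.
    by exists (Un t); eexists; exact: coding_Un lx xz fP.
  by exists Lf; eexists; exact: coding_Lf.
- have [_ imm] := stree_succ1 lx.
  have [|t1 [f1 f1P]] := IH (lsucc x); first by apply/imm; left.
  have [|t2 [f2 f2P]] := IH (rsucc x); first by apply/imm; right.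
  by exists (Bin t1 t2); eexists; exact: coding_Bin lx f1P f2P.
Qed.

(** Coding from [\bot] reaches all nodes, and the root label 0 makes the coded tree [nonbin], hence
    a term. *)
Lemma exists_stree_of : exists s, stree_iso (stree_of s) T.
Proof.
have [t [f fP]] := exists_coding \bot.
have [|s st] := @utree_of_surj t.
  apply: negbNE; rewrite -binary_nil.
  have := coding_label fP (node_nil t).
  by rewrite (coding_nil fP) stree_root; case: binary.
move: fP; rewrite -{}st => fP.
have f_inj : injective (fun x : stree_of s => f (addr x)).
  move=> x y e; apply: addr_inj; apply: prefix_anti.
  by rewrite -!(coding_le fP) ?node_addr // e lexx.
exists s, (fun x => f (addr x)); split.
- apply: inj_surj_bij f_inj _ => y.
  have [p n <-] := coding_surj fP (le0x y).
  by exists (tnode_at _ p); rewrite addr_at.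
- by move=> x y; rewrite (coding_le fP) ?node_addr.
- move=> x; apply: val_inj; rewrite /= (coding_label fP) ?node_addr //.
  by rewrite [RHS]tlabelE.
- move=> x; rewrite /= tlabelE => /eqP; rewrite eqb1 => bx.
  by rewrite !addr_child ?node_rcons //; exact: (coding_succ fP).
Qed.

End Coding.

(** * The order isomorphism onto isomorphism classes *)

Lemma iso_class_subproof (s : TB) :
  exists T, forall T', stree_iso (stree_of s) T' <-> stree_iso T T'.
Proof. by exists (stree_of s). Qed.

Definition iso_class (s : TB) : Tbar2 :=
  exist _ (stree_iso (stree_of s)) (iso_class_subproof s).

Theorem lemma2p27 : order_isomorphic TB_le Tbar2_le.
Proof.
exists iso_class; split.
  apply: inj_surj_bij => [s t /(congr1 sval) /= e|[C [T CT]]].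
    by apply: stree_of_iso_inj; rewrite e; exact: stree_iso_refl.
  (* Classes are predicates, so by extensionality it is enough that [C] and the class of [s] have
     the same members. *)
  have [s sT] := exists_stree_of T; exists s; apply: eq_exist.
  apply/funext => T'; apply/propext; rewrite CT; split.
    exact/stree_iso_trans/stree_iso_sym.
  exact: stree_iso_trans.
move=> s t; rewrite stree_of_le; split=> [st|[T1 [T2 /= [sT1 tT2 T12]]]].
  by exists (stree_of s), (stree_of t); split=> //; exact: stree_iso_refl.
apply: stree_le_isol sT1 _; apply: stree_le_isor T12 _; exact: stree_iso_sym.
Qed.
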